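(* Let $q\in\mathbb{N}$ and let $T$ be a $(q+1)$-homogeneous tree. For $1\leq p<\infty$, the differentiation operator $D$ is not compact on the Hardy space $\mathbb{T}_p(T)$.
   Context: A tree $T$ is a locally finite, connected, simply-connected graph, identified with its set of vertices, and rooted at a vertex $o$. It is $(q+1)$-homogeneous ($q\in\mathbb{N}=\{1,2,\dots\}$) if every vertex has exactly $q+1$ neighbors. For a vertex $v$, $|v|$ is the number of edges in the path from $o$ to $v$. For $v\neq o$, $v^-$ denotes the unique neighbor of $v$ lying on the path from $o$ to $v$ (the parent of $v$). The derivative of $f:T\to\mathbb{C}$ is $f'(v)=f(v)-f(v^-)$ for $v\neq o$ and $f'(o)=0$; the differentiation operator is $Df=f'$. For $1\leq p<\infty$, set $M_p(0,f)=|f(o)|$ and, for $n\in\mathbb{N}$, \[M_p(n,f)=\left(\frac{1}{(q+1)q^{n-1}}\sum_{|v|=n}|f(v)|^p\right)^{1/p}.\] The Hardy space $\mathbb{T}_p(T)$ is the set of all $f:T\to\mathbb{C}$ with $\|f\|_p=\sup_{n\in\mathbb{N}_0}M_p(n,f)<\infty$, where $\mathbb{N}_0=\mathbb{N}\cup\{0\}$; it is a Banach space under $\|\cdot\|_p$. $D$ is compact on $\mathbb{T}_p(T)$ if for every bounded sequence $\{x_n\}$ in $\mathbb{T}_p(T)$ the sequence $\{Dx_n\}$ has a convergent subsequence in $\mathbb{T}_p(T)$. *)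

(* Defs.v *)
From mathcomp Require Export all_boot all_order all_algebra complex.
From mathcomp Require Export all_classical all_reals all_analysis.

Set Implicit Arguments.
Unset Strict Implicit.
Unset Printing Implicit Defensive.

Import Order.TTheory GRing.Theory Num.Theory.
Import numFieldNormedType.Exports.
Import ComplexField.Normc.

Local Open Scope classical_set_scope.
Local Open Scope card_scope.
Local Open Scope ring_scope.

Section Trees.
Variables (V : choiceType) (e : rel V).

(* A graph on [V] is given by its adjacency relation. The empty sequence is an
   [ucycle], and [:: u; v] is one for every edge uv (traversed back and forth);
   the genuine cycles are those of length at least 3. *)
Record is_tree : Prop := IsTree {
  tree_symmetric : symmetric e ;
  tree_irreflexive : irreflexive e ;
  tree_locally_finite : forall v, finite_set [set w | e v w] ;
  tree_connected : forall u v, exists s, path e u s /\ last u s = v ;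
  tree_acyclic : forall c, ucycle e c -> (size c <= 2)%N
}.

Definition homogeneous_tree (q : nat) : Prop :=
  is_tree /\ forall v, [set w | e v w] #= `I_q.+1.

Variable o : V.

(* The path from [o] to [v], without its first vertex [o]; it is unique in a
   tree. *)
Definition tree_path (v : V) : seq V :=
  xget [::] [set s | [/\ path e o s, uniq (o :: s) & last o s = v]].

Definition depth (v : V) : nat := size (tree_path v).

(* Only meaningful for v != o; the default value [v] of [xget] is irrelevant
   then. *)
Definition parent (v : V) : V :=
  xget v [set w | e v w /\ w \in o :: tree_path v].

End Trees.

Section Hardy.
Variables (R : realType) (V : choiceType) (e : rel V) (o : V).

Definition differentiation (f : V -> R[i]) (v : V) : R[i] :=
  if v == o then 0 else f v - f (parent e o v).

Variables (q : nat) (p : R).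

(* The sum over [v \in A] is the finitely supported one, a genuine sum here
   because the spheres of a locally finite tree are finite. *)
Definition hardy_mean (n : nat) (f : V -> R[i]) : R :=
  if n is m.+1 then
    (((q.+1 * q ^ m)%N%:R)^-1 *
      \sum_(v \in [set v | depth e o v = n]) (normc (f v) `^ p))
    `^ p^-1
  else normc (f o).

Definition hardy_norm (f : V -> R[i]) : \bar R :=
  ereal_sup (range (fun n => (hardy_mean n f)%:E)).

Definition hardy_space : set (V -> R[i]) :=
  [set f | (hardy_norm f < +oo)%E].

Definition hardy_bounded (x : nat -> V -> R[i]) : Prop :=
  (forall n, hardy_space (x n)) /\
  exists M : R, forall n, (hardy_norm (x n) <= M%:E)%E.

Definition hardy_cvg (x : nat -> V -> R[i]) (g : V -> R[i]) : Prop :=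
  [/\ forall n, hardy_space (x n), hardy_space g &
      hardy_norm (fun v => x n v - g v) @[n --> \oo] --> 0%E].

Definition hardy_compact (A : (V -> R[i]) -> V -> R[i]) : Prop :=
  forall x, hardy_bounded x ->
    exists k : nat -> nat, {homo k : i j / (i < j)%N} /\
      exists g, hardy_cvg (fun j => A (x (k j))) g.

End Hardy.

(* Main.v *)
Require Import Defs.

Set Implicit Arguments.
Unset Strict Implicit.
Unset Printing Implicit Defensive.

Import Order.TTheory GRing.Theory Num.Theory.

Import ComplexField.Normc.

Local Open Scope classical_set_scope.
Local Open Scope card_scope.
Local Open Scope ring_scope.

(** Point evaluations are continuous on the Hardy space: the [p]-th power of
    [|h v|] is a single nonnegative term of the sum over the sphere of radius
    [depth v], so [|h v| <= peak v * ||h||], where [peak v] is the [p]-th root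
    of the weight [(q+1)q^(n-1)] of that sphere ([normc_le_peak_mean]). The
    constant is sharp: the function [bump v], supported at [v] with value
    [peak v] there, has norm at most 1 ([hardy_norm_bump_le1]).

    A homogeneous tree with at least two neighbors at every vertex is infinite
    ([infinite_tree]), so there are pairwise distinct vertices [u n <> o], and
    the functions [bump (u n)] form a bounded sequence. Suppose that [D] maps a
    subsequence, given by [k], to one converging to [g], and take [N] such that
    the distance to [g] is less than 1/2 from the index [N] on. At the vertex
    [v = u (k N)] the derivative of [bump v] is [peak v], whereas the
    derivative of [bump (u (k j))] vanishes at [v] for some [j > N], since only
    [u (k j) = v] and [u (k j) = parent v] could prevent this. By continuity of
    the evaluation at [v], the value [g v] is at distance less than
    [peak v / 2] both from [peak v] and from 0, which is absurd. *)

Section TreeGeometry.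
Variables (V : choiceType) (e : rel V) (o : V).

Lemma tree_pathP (v : V) : is_tree e ->
  [/\ path e o (tree_path e o v), uniq (o :: tree_path e o v)
    & last o (tree_path e o v) = v].
Proof.
move=> T; have [s [es <-]] := tree_connected T o v.
have [s' es' us' _] := shortenP es.
rewrite /tree_path; apply: (@xgetPex _ _
  [set s0 | [/\ path e o s0, uniq (o :: s0) & last o s0 = last o s']]).
by exists s'.
Qed.

Lemma depth_eq0 (v : V) : is_tree e -> depth e o v = 0%N -> v = o.
Proof. by move=> /(tree_pathP v)[_ _ lv] /size0nil pv; rewrite -lv pv. Qed.

(** A sphere consists of endpoints of walks of a fixed length, and there are
    finitely many of these by local finiteness. This makes the finitely
    supported sums over spheres genuine sums for every function. *)
Lemma finite_sphere (n : nat) : is_tree e ->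
  finite_set [set v | depth e o v = n].
Proof.
move=> T.
have fin_walk : finite_set [set v | exists s, [/\ path e o s, size s = n
    & last o s = v]].
  elim: n => [|n IHn].
    apply: sub_finite_set (finite_set1 o) => v [s [_ /size0nil -> <-]] //.
  apply: sub_finite_set (bigcup_finite IHn
    (fun w _ => tree_locally_finite T w)) => v [s].
  case/lastP: s => [[]//|s w] [].
  rewrite rcons_path size_rcons last_rcons => /andP[es ew] [sn] <-.
  by exists (last o s) => //; exists s.
apply: sub_finite_set fin_walk => v dv; exists (tree_path e o v).
by have [? _ ?] := tree_pathP v T.
Qed.

(** A nontrivial path from [o] to [v] has a vertex just before [v], so the
    default value [v] in the choice of the parent is not the one taken. *)
Lemma parent_neq (v : V) : is_tree e -> v != o -> parent e o v != v.
Proof.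
move=> T vo; rewrite /parent.
set A := [set w | e v w /\ w \in o :: tree_path e o v].
have : A (xget v A).
  apply: xgetPex; rewrite /A; have [] := tree_pathP v T.
  case/lastP: (tree_path e o v) => [_ _ /= ov|s w]; first by rewrite ov eqxx in vo.
  rewrite rcons_path last_rcons => /andP[_ ew] _ <-.
  exists (last o s); split; first by rewrite (tree_symmetric T).
  by rewrite -rcons_cons mem_rcons in_cons mem_last orbT.
case=> ev _; apply: contraTneq ev => ->.
by rewrite (tree_irreflexive T).
Qed.

Lemma exists_other_neighbor (q : nat) (u x : V) : (0 < q)%N ->
  homogeneous_tree e q -> exists2 w, e u w & w != x.
Proof.
move=> q0 [_ /(_ u) euq]; apply: contrapT => Nw.
have : `I_q.+1 #<= `I_1.
  have /card_eqPle[_ Iq] := euq.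
  have /card_eqPle[x1 _] := @card_set1 _ x.
  apply: card_le_trans Iq _; apply: card_le_trans x1.
  apply: subset_card_le => w /= uw; apply: contrapT => /eqP wx.
  by apply: Nw; exists w.
by rewrite card_le_II ltnS leqNgt q0.
Qed.

(** A simple path is prolonged by a neighbor of its endpoint other than the
    vertex just before it: if this neighbor were already on the path, it would
    close a cycle of length at least 3. *)
Lemma exists_simple_path (q : nat) (n : nat) : (0 < q)%N ->
  homogeneous_tree e q ->
  exists s, [/\ path e o s, uniq (o :: s) & size s = n].
Proof.
move=> q0 hT; have [T _] := hT; elim: n => [|n [s [es us sn]]]; first by exists [::].
(* For the empty path the vertex to avoid is [o] itself, which is harmless. *)
have [w ew wx] :=
  exists_other_neighbor (last o s) (last o (take (size s).-1 s)) q0 hT.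
exists (rcons s w); split.
- by rewrite rcons_path es.
- rewrite -rcons_cons rcons_uniq us andbT; apply/negP => ws.
  (* [w] is the endpoint of the initial part [p1]; the cycle is [w :: p2]. *)
  case/splitPl: ws es us ew wx {sn} => p1 p2 p1w.
  rewrite cat_path last_cat p1w -cat_cons lastI cat_rcons cat_uniq p1w.
  move=> /andP[_ ep2] /and3P[_ _ up2] ew wx.
  have := @tree_acyclic _ _ T (w :: p2).
  have /[swap]/[apply] : ucycle e (w :: p2).
    by rewrite /ucycle /ucycleb (cycle_path w) /= ew ep2.
  case: p2 {ep2 up2} ew wx => [|v [|//]] /= ew wx _.
    by rewrite (tree_irreflexive T) in ew.
  by move: wx; rewrite size_cat addn1 /= take_size_cat // p1w eqxx.
- by rewrite size_rcons sn.
Qed.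

Lemma infinite_tree (q : nat) : (0 < q)%N -> homogeneous_tree e q ->
  infinite_set [set v | v != o].
Proof.
move=> q0 hT /finite_seqP[X XE].
have [s [_ /= /andP[os us] sX]] := exists_simple_path (size X).+1 q0 hT.
have /(uniq_leq_size us) : {subset s <= X}.
  move=> v vs; have : [set v | v != o] v by apply: contraNneq os => <-.
  by rewrite XE.
by rewrite sX ltnn.
Qed.

End TreeGeometry.

(** [infiniteP] stated without any pointedness assumption on the type. *)
Lemma infinite_set_sequence (T : Type) (A : set T) : infinite_set A ->
  exists2 u : nat -> T, injective u & forall n, A (u n).
Proof.
move=> /infiniteP/card_leP[f].
exists (fun n => val (f (SigSub (mem_set (I : [set: nat] n))))).
  move=> i j /val_inj fij.
  have /(congr1 val) // := 'inj_f (mem_set (I : setT _)) (mem_set (I : setT _)) fij.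
by move=> n; apply: set_mem; apply: valP.
Qed.

Section HardyEstimates.
Variables (R : realType) (V : choiceType) (e : rel V) (o : V).
Variables (q : nat) (p : R).

(** The norm of the evaluation at [v]: the [p]-th root of the cardinality of
    the sphere through [v]. *)
Definition peak (v : V) : R :=
  if depth e o v is m.+1 then ((q.+1 * q ^ m)%N%:R) `^ p^-1 else 1.

Lemma weight_gt0 (m : nat) : (0 < q)%N -> 0 < (q.+1 * q ^ m)%N%:R :> R.
Proof. by move=> q0; rewrite ltr0n muln_gt0 expn_gt0 q0. Qed.

Lemma peak_gt0 (v : V) : (0 < q)%N -> 0 < peak v.
Proof.
by move=> q0; rewrite /peak; case: depth => // m; apply/powR_gt0/weight_gt0.
Qed.

Definition bump (v w : V) : R[i] := if w == v then (peak v)%:C%C else 0.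

Lemma normc_real (x : R) : 0 <= x -> normc (x%:C%C) = x.
Proof. by move=> x0; rewrite /= expr0n addr0 sqrtr_sqr ger0_norm. Qed.

Lemma normc_ge0 (z : R[i]) : 0 <= normc z.
Proof. by case: z => a b; apply: sqrtr_ge0. Qed.

Lemma hardy_mean_bump_le1 (n : nat) (v : V) : (0 < q)%N -> 1 <= p ->
  v != o -> hardy_mean e o q p n (bump v) <= 1.
Proof.
move=> q0 p1 vo; have p0 : 0 < p by apply: lt_le_trans p1.
case: n => [|n] /=.
  by rewrite /bump eq_sym (negbTE vo) normc0.
have [dv|dv] := eqVneq (depth e o v) n.+1.
  rewrite -(@fsbig_widen _ _ _ _ [set v]); last 2 first.
  - by move=> w ->.
  - move=> w [_ /= /eqP/negbTE wv]; rewrite /= /bump wv normc0 powR0 //.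
    by rewrite gt_eqF.
  rewrite fsbig_set1 /bump eqxx normc_real ?(ltW (peak_gt0 _ _))// /peak dv.
  rewrite -powRrM mulVf ?(gt_eqF p0)// powRr1 ?ler0n// mulVf ?powR1//.
  by rewrite gt_eqF// weight_gt0.
rewrite fsbig1 ?mulr0 ?powR0 ?ler01 ?invr_eq0 ?gt_eqF// => w /= dw.
have /negbTE wv : w != v by apply: contraNneq dv => <-; apply/eqP.
by rewrite /bump wv normc0 powR0 ?gt_eqF.
Qed.

Lemma hardy_norm_bump_le1 (v : V) : (0 < q)%N -> 1 <= p ->
  v != o -> (hardy_norm e o q p (bump v) <= 1%:E)%E.
Proof.
move=> q0 p1 vo; apply: ge_ereal_sup => _ [n _ <-].
by rewrite lee_fin hardy_mean_bump_le1.
Qed.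

(** Dropping all the terms but [v] from the mean over the sphere through [v]
    decreases it, as the terms are nonnegative and the sphere is finite. *)
Lemma normc_le_peak_mean (h : V -> R[i]) (v : V) : is_tree e ->
  (0 < q)%N -> 1 <= p ->
  normc (h v) <= peak v * hardy_mean e o q p (depth e o v) h.
Proof.
move=> T q0 p1; have p0 : 0 < p by apply: lt_le_trans p1.
rewrite /peak /hardy_mean; case dv: (depth e o v) => [|m].
  by rewrite mul1r (depth_eq0 T dv).
have w0 := weight_gt0 m q0.
have S0 (A : set V) : 0 <= \sum_(w \in A) (normc (h w) `^ p).
  by apply: fsumr_ge0 => w _; apply: powR_ge0.
rewrite -powRM ?mulr_ge0 ?invr_ge0 ?(ltW w0)// mulVKf ?gt_eqF//.
have <- : (normc (h v) `^ p) `^ p^-1 = normc (h v).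
  by rewrite -powRrM divff ?gt_eqF// powRr1// normc_ge0.
apply: ge0_ler_powR; rewrite ?nnegrE ?invr_ge0 ?(ltW p0) ?powR_ge0//.
rewrite (fsbigD1 v) //=; last exact: finite_sphere.
by rewrite lerDl.
Qed.

(** The form in which the continuity of evaluations is applied: two values
    this close to [g v] cannot be [peak v] apart. *)
Lemma normc_lt_half_peak (h : V -> R[i]) (v : V) : is_tree e ->
  (0 < q)%N -> 1 <= p -> (hardy_norm e o q p h < (2^-1)%:E)%E ->
  normc (h v) < peak v / 2.
Proof.
move=> T q0 p1 h2; apply: le_lt_trans (normc_le_peak_mean h v T q0 p1) _.
rewrite ltr_pM2l ?peak_gt0// -lte_fin; apply: le_lt_trans h2.
by apply: ereal_sup_ubound; exists (depth e o v).
Qed.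

Lemma differentiation_bump (u v : V) : v != o -> v != u ->
  parent e o v != u -> differentiation e o (bump u) v = 0.
Proof.
move=> /negbTE vo /negbTE vu /negbTE pu.
by rewrite /differentiation vo /bump vu pu subrr.
Qed.

Lemma differentiation_bump_peak (v : V) : is_tree e -> v != o ->
  differentiation e o (bump v) v = (peak v)%:C%C.
Proof.
move=> T vo; have /negbTE pv := parent_neq T vo.
by rewrite /differentiation (negbTE vo) /bump eqxx pv subr0.
Qed.

End HardyEstimates.

Theorem corollary5p5 (R : realType) (V : choiceType) (e : rel V) (o : V)
    (q : nat) (p : R) :
  (0 < q)%N -> homogeneous_tree e q -> 1 <= p ->
  ~ hardy_compact e o q p (differentiation e o).
Proof.
move=> q0 hT p1; have [T _] := hT.
have [u uI uo] := infinite_set_sequence (infinite_tree (o := o) q0 hT).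
pose x n := bump e o q p (u n).
have xB n : (hardy_norm e o q p (x n) <= 1%:E)%E by exact: hardy_norm_bump_le1 (uo n).
have bx : hardy_bounded e o q p x.
  split; last by exists 1.
  by move=> n; apply: le_lt_trans (xB n) _; rewrite ltry.
move=> /(_ x bx)[k [kI [g [_ _ cg]]]].
have half0 : (0%E < (2^-1)%:E :> \bar R)%E by rewrite lte_fin invr_gt0 ltr0n.
have [N _ small] := cg _ (open_ereal_lt' half0).
have kinj : injective k.
  move=> i j kij; case: (ltngtP i j) => // /kI; by rewrite kij ltnn.
pose v := u (k N).
(* [u] and [k] are injective, so that at most one of the two indices [N.+1]
   and [N.+2] yields the parent of [v]. *)
have [j Nj pj] : exists2 j, (N < j)%N & parent e o v != u (k j).
  have [pN1|] := eqVneq (parent e o v) (u (k N.+1)); last by exists N.+1.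
  exists N.+2 => //; rewrite pN1; apply/eqP => /uI/kinj/eqP.
  by rewrite eqn_leq ltnn andbF.
have vj : v != u (k j).
  by apply/eqP => /uI/kinj Nj'; rewrite Nj' ltnn in Nj.
have := normc_lt_half_peak v T q0 p1 (small N (leqnn N)).
have := normc_lt_half_peak v T q0 p1 (small j (ltnW Nj)).
rewrite /x differentiation_bump ?uo// differentiation_bump_peak ?uo//.
rewrite sub0r normcN -/v => gv cgv.
have := le_normcD ((peak e o q p v)%:C%C - g v) (g v).
rewrite subrK normc_real ?(ltW (peak_gt0 _ _ _ _ _))// => le_peak.
have := le_lt_trans le_peak (ltrD cgv gv).
by rewrite -mulrDl -mulr2n -(mulr_natr (peak e o q p v)) mulfK ?pnatr_eq0// ltxx.
Qed.
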